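(* Let $\mathcal{G}$ be the compact graph with two vertices $v_1,v_2$ and three edges of length $2\pi$, each joining $v_1$ to $v_2$, with Hamiltonian $H_0=-\partial_x^2$ and Neumann--Kirchhoff conditions at both vertices. For every integers $k,l\ge0$, $k\ne l$, two eigenfunctions corresponding to $\left(\frac{k}{2}\right)^2$ and $\left(\frac{l}{2}\right)^2$ do not share the same modulus.
   Context: Each edge is parameterized by $[0,2\pi]$, oriented from $v_1$ (coordinate $0$) to $v_2$ (coordinate $2\pi$). Functions on $\mathcal{G}$ are triples $f=(f^1,f^2,f^3)$ of complex-valued functions on $[0,2\pi]$, and $L^2(\mathcal{G})=\bigoplus_{j=1}^3L^2(0,2\pi)$. The domain of $H_0=-\partial_x^2$ is the set of $f$ with $f^j\in H^2(0,2\pi)$, $f^1(0)=f^2(0)=f^3(0)$, $f^1(2\pi)=f^2(2\pi)=f^3(2\pi)$, $\sum_{j=1}^3\partial_xf^j(0)=0$ and $\sum_{j=1}^3\partial_xf^j(2\pi)=0$. The eigenvalues of $H_0$ are exactly $(k/2)^2$, $k\ge0$. Two $\mathbb{C}$-linearly independent eigenfunctions share the same modulus if their moduli coincide at every point of $\mathcal{G}$. *)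

(* Defs.v *)
From HB Require Import structures.
From mathcomp Require Import all_boot all_order all_algebra.
From mathcomp Require Import complex.
From mathcomp Require Import all_classical all_reals all_analysis.

Set Implicit Arguments.
Unset Strict Implicit.
Unset Printing Implicit Defensive.

Import Order.TTheory GRing.Theory Num.Theory.
Import numFieldNormedType.Exports.

Local Open Scope classical_set_scope.
Local Open Scope ring_scope.
Local Open Scope complex_scope.

Section ThetaGraph.
Variable R : realType.

(* A complex function on [0, 2pi] is a map R -> R[i] whose values outside
   [0, 2pi] are never used; edge j of the graph carries the j-th component. *)
Definition edge_fun : Type := R -> R[i].
Definition graph_fun : Type := 'I_3 -> edge_fun.

Definition edge : set R := `]0, 2 * pi[%classic.
Definition cedge : set R := `[0, 2 * pi]%classic.

(* The topology on R[i] is the one of its regular normed module R[i]^o. *)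
Definition continuous_edge (u : edge_fun) : Prop :=
  {within cedge, continuous (u : R -> R[i]^o)}.

Definition L2 (u : edge_fun) : Prop :=
  [/\ measurable_fun edge (fun x => complex.Re (u x)),
      measurable_fun edge (fun x => complex.Im (u x)) &
      (\int[lebesgue_measure]_(x in edge)
         ((complex.Re (u x) ^+ 2 + complex.Im (u x) ^+ 2)%:E) < +oo)%E].

Definition cintegral (u : edge_fun) : R[i] :=
  (\int[lebesgue_measure]_(x in edge) complex.Re (u x))%R +i*
  (\int[lebesgue_measure]_(x in edge) complex.Im (u x))%R.

(* Compactly supported test functions of class C^1, as in Brezis; smooth ones
   yield the same weak derivatives. *)
Definition test_fun (phi : R -> R) : Prop :=
  [/\ forall x, derivable phi x 1,
      continuous (derive1 phi) &
      closure [set x | phi x != 0] `<=` edge].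

(* v is the weak derivative of u, both being in L^2(0, 2pi). *)
Definition weak_deriv (u v : edge_fun) : Prop :=
  [/\ L2 u, L2 v &
      forall phi : R -> R, test_fun phi ->
        cintegral (fun x => u x * (derive1 phi x)%:C) =
        - cintegral (fun x => v x * (phi x)%:C)].

Definition H2 (u : edge_fun) : Prop :=
  exists v w, weak_deriv u v /\ weak_deriv v w.

(* An element of H^2(0, 2pi) and its first derivative have unique continuous
   representatives on [0, 2pi]; f j and df j are these representatives, so
   that the vertex values below are the traces. *)
Definition dom_H0 (f : graph_fun) : Prop :=
  [/\ forall j, H2 (f j) /\ continuous_edge (f j),
      forall i j, f i 0 = f j 0,
      forall i j, f i (2 * pi) = f j (2 * pi) &
      exists df : graph_fun,
        [/\ forall j, weak_deriv (f j) (df j) /\ continuous_edge (df j),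
            \sum_(j < 3) df j 0 = 0 &
            \sum_(j < 3) df j (2 * pi) = 0]].

(* H_0 f = h in L^2; weak derivatives, hence this relation, are insensitive
   to changes of h on a null set. *)
Definition H0_maps (f h : graph_fun) : Prop :=
  dom_H0 f /\
  forall j, exists v, weak_deriv (f j) v /\ weak_deriv v (fun x => - h j x).

Definition eigenfunction (lam : R[i]) (f : graph_fun) : Prop :=
  H0_maps f (fun j x => lam * f j x) /\
  exists j x, cedge x /\ f j x != 0.

(* Sharing the same modulus is a relation between linearly independent
   eigenfunctions; independence is not repeated here, as it is automatic for
   eigenfunctions of distinct eigenvalues. *)
Definition same_modulus (f g : graph_fun) : Prop :=
  forall j x, cedge x -> `|f j x| = `|g j x|.

End ThetaGraph.

(* Main.v *)
Require Import Defs.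
From HB Require Import structures.
From mathcomp Require Import all_boot all_order all_algebra.
From mathcomp Require Import complex ring lra.
From mathcomp Require Import all_classical all_reals all_analysis.

Import Order.TTheory GRing.Theory Num.Theory.
Import numFieldNormedType.Exports.

Local Open Scope classical_set_scope.
Local Open Scope ring_scope.
Local Open Scope complex_scope.

(** Write [om = k / 2] for the frequency of the first eigenfunction [f] and
suppose [0 < k], as we may since [k] and [l] are distinct and the claim is
symmetric.  On each edge [f] solves [u'' = - om^2 u].  Continuity at the first
vertex makes [a := f^j(0)] independent of [j], and the Kirchhoff condition there
gives [f^j(x) = a cos (om x) + b_j sin (om x)] with [b_1 + b_2 + b_3 = 0].  Then
[|f^j|^2] is a constant plus
[(|a|^2 - |b_j|^2) / 2 * cos (k x) + Re (a conj(b_j)) * sin (k x)], whereas the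
squared modulus of the other eigenfunction is a constant plus a sinusoid of
frequency [l <> k] (just a constant if [l = 0]).  Distinct frequencies are
linearly independent on [0, 2 pi] ([sinusoid_sep]), so equal moduli force
[|b_j| = |a|] and [Re (a conj(b_j)) = 0], that is [b_j = i a] or [b_j = - i a].
A sum of three such numbers is an odd multiple of [i a], so it vanishes only if
[a = 0] ([isotropic_sum3]); then every [b_j] is zero too, and [f = 0] is not an
eigenfunction.

The analytic part is that weak solutions of the equation are classical.  Let [u]
and [p] be the continuous representatives of a solution and of its derivative,
and let [c] be a classical solution.  Testing the weak equations against
[c * phi] and [c' * phi] shows that the Wronskian [u c' - p c] has zero weak
derivative ([wronskian_cst]), hence is constant by the du Bois-Reymond lemma
([du_bois_reymond]).  The Wronskians with two independent classical solutions
determine [u] ([weak_solutionE]).  The du Bois-Reymond lemma needs localized test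
functions that are twice differentiable; these are obtained from a quadratic
spline. *)

(** * A quadratic spline bump *)

Section Splines.
Variable R : realType.
Implicit Types x t : R.

Lemma is_derive_mul_norm x : is_derive x 1 (fun t => t * `|t|) (2 * `|x|).
Proof.
have [x0|x0|x0] := ltgtP x 0.
- have e : {near x, (fun t : R => - (t ^+ 2)) =1 (fun t => t * `|t|)}.
    near=> t; have t0 : t < 0 by near: t; exact: lt_nbhsl.
    by rewrite ltr0_norm//; ring.
  apply: (@near_eq_is_derive _ _ _ _ _ x 1 _ e).
  by apply: is_derive_eq; rewrite ltr0_norm// /GRing.scale/=; ring.
- have e : {near x, (fun t : R => t ^+ 2) =1 (fun t => t * `|t|)}.
    near=> t; have t0 : 0 < t by near: t; exact: lt_nbhsr.
    by rewrite gtr0_norm//; ring.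
  apply: (@near_eq_is_derive _ _ _ _ _ x 1 _ e).
  by apply: is_derive_eq; rewrite gtr0_norm// /GRing.scale/=; ring.
- rewrite x0 normr0 mulr0.
  have c : (fun h : R => h^-1 *: ((h *: 1 + 0) * `|h *: 1 + 0 : R| - 0 * `|0 : R|)) @ 0^'
      --> (0 : R).
    have e : \forall h \near (0 : R)^',
        `|h| = h^-1 *: ((h *: 1 + 0) * `|h *: 1 + 0 : R| - 0 * `|0 : R|).
      near=> h; have h0 : h != 0 by near: h; exact: nbhs_dnbhs_neq.
      by rewrite !addr0 mul0r subr0 /GRing.scale/= !mulr1; field.
    have n0 : (fun h : R => `|h|) @ 0^' --> `|0 : R|.
      by apply: cvg_within_filter; exact: norm_continuous.
    rewrite normr0 in n0.
    exact: cvg_trans (near_eq_cvg e) n0.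
  apply: DeriveDef; first by apply/cvg_ex; exists 0.
  exact: cvg_lim.
Unshelve. all: by end_near. Qed.

(** Third difference of [t |-> t * `|t|], which is [2 * max 0 t ^ 2 - t ^ 2];
third differences kill the polynomial [t ^ 2], so this is a multiple of the
quadratic B-spline with knots 0, 1, 2, 3.  Written with the norm, its calculus
reduces to [is_derive_mul_norm]. *)
Definition spline (t : R) : R :=
  t * `|t| - 3 * ((t - 1) * `|t - 1|) + 3 * ((t - 2) * `|t - 2|) - (t - 3) * `|t - 3|.

(** A primitive of [3 * spline], up to the additive constant that makes it odd
about [3 / 2]. *)
Definition spline_prim (t : R) : R :=
  t * (t * `|t|) - 3 * ((t - 1) * ((t - 1) * `|t - 1|)) +
  3 * ((t - 2) * ((t - 2) * `|t - 2|)) - (t - 3) * ((t - 3) * `|t - 3|).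

Definition spline_der (t : R) : R :=
  2 * `|t| - 3 * (2 * `|t - 1|) + 3 * (2 * `|t - 2|) - 2 * `|t - 3|.

Lemma spline_prim_left t : t <= 0 -> spline_prim t = - 6.
Proof. by move=> t0; rewrite /spline_prim !ler0_norm; try lra; ring. Qed.

Lemma spline_prim_right t : 3 <= t -> spline_prim t = 6.
Proof. by move=> t0; rewrite /spline_prim !ger0_norm; try lra; ring. Qed.

Lemma spline_ge0 t : 0 <= spline t.
Proof.
rewrite /spline; case: (ger0P t) => ?; case: (ger0P (t - 1)) => ?;
  case: (ger0P (t - 2)) => ?; case: (ger0P (t - 3)) => ?; try lra; nra.
Qed.

Lemma spline_out t : t <= 0 \/ 3 <= t -> spline t = 0.
Proof.
move=> [t0|t0]; rewrite /spline.
  by rewrite !ler0_norm; try lra; ring.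
by rewrite !ger0_norm; try lra; ring.
Qed.

Lemma is_derive_shift (f : R -> R) (d c t : R) :
  is_derive (t - c) 1 f d -> is_derive t 1 (fun x => f (x - c)) d.
Proof.
move=> fd.
have h : is_derive t 1 (fun x : R => x - c) 1.
  by apply: is_derive_eq; rewrite subr0.
by have := @is_derive1_comp R f (fun x => x - c) t d 1 fd h; rewrite mulr1.
Qed.

Lemma is_derive_sq_norm t : is_derive t 1 (fun t => t * (t * `|t|)) (3 * (t * `|t|)).
Proof.
have := is_derive_mul_norm t => h.
by apply: is_derive_eq; rewrite /GRing.scale/=; ring.
Qed.

Lemma is_derive_spline_prim t : is_derive t 1 spline_prim (3 * spline t).
Proof.
have h0 := is_derive_sq_norm t.
have h1 := is_derive_shift _ _ 1 t (is_derive_sq_norm (t - 1)).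
have h2 := is_derive_shift _ _ 2 t (is_derive_sq_norm (t - 2)).
have h3 := is_derive_shift _ _ 3 t (is_derive_sq_norm (t - 3)).
rewrite /spline_prim.
by apply: is_derive_eq; rewrite /spline/GRing.scale/=; ring.
Qed.

Lemma is_derive_spline t : is_derive t 1 spline (spline_der t).
Proof.
have h0 := is_derive_mul_norm t.
have h1 := is_derive_shift _ _ 1 t (is_derive_mul_norm (t - 1)).
have h2 := is_derive_shift _ _ 2 t (is_derive_mul_norm (t - 2)).
have h3 := is_derive_shift _ _ 3 t (is_derive_mul_norm (t - 3)).
rewrite /spline.
by apply: is_derive_eq; rewrite /spline_der/GRing.scale/=; ring.
Qed.

Lemma continuous_spline_der : continuous spline_der.
Proof.
have nc c : continuous (fun x : R => `|x - c|).
  move=> x; apply: (@continuous_comp _ _ _ (fun x => x - c) (fun x => `|x|)).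
    by apply: cvgB; [exact: cvg_id|exact: cvg_cst].
  exact: norm_continuous.
move=> x; rewrite /spline_der.
apply: cvgB; [apply: cvgD; [apply: cvgB|]|]; try
 (repeat (apply: cvgM; [exact: cvg_cst|]); first [exact: norm_continuous|exact: nc]).
Qed.

End Splines.

(** * Test functions and the du Bois-Reymond lemma *)

Section EdgeIntegrals.
Variable R : realType.
Implicit Types (x t : R) (u w p phi : R -> R).
Local Notation edgeR := (@edge R).
Local Notation cedgeR := (@cedge R).
Local Notation mu := (@lebesgue_measure R).

Lemma is_derive_affine (f : R -> R) (d k c t : R) :
  is_derive (k * (t - c)) 1 f d -> is_derive t 1 (fun x => f (k * (x - c))) (k * d).
Proof.
move=> fd.
have h : is_derive t 1 (fun x : R => k * (x - c)) k.
  by apply: is_derive_eq; rewrite /GRing.scale/=; ring.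
by have := @is_derive1_comp R f (fun x => k * (x - c)) t d k fd h; rewrite mulrC.
Qed.

Lemma is_derive_derive1 (f f' : R -> R) :
  (forall x, is_derive x 1 f (f' x)) -> derive1 f = f'.
Proof. by move=> fd; apply/funext => x; rewrite derive1E; case: (fd x). Qed.

Lemma is_derive_continuous (f f' : R -> R) :
  (forall x, is_derive x 1 f (f' x)) -> continuous f.
Proof.
move=> fd x; apply: differentiable_continuous; apply/derivable1_diffP.
by case: (fd x).
Qed.

Lemma test_funI phi phi' m M : (forall x, is_derive x 1 phi (phi' x)) ->
  continuous phi' -> 0 < m -> M < 2 * pi ->
  (forall x, x < m \/ M < x -> phi x = 0) -> test_fun phi.
Proof.
move=> phid phic m0 M2 phi0; split.
- by move=> x; case: (phid x).
- by rewrite (is_derive_derive1 _ _ phid).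
- apply: subset_trans (_ : `[m, M] `<=` _).
    rewrite closureE; apply: smallest_sub; first exact: interval_closed.
    move=> x /= /eqP phix; rewrite in_itv/=; apply/andP; split; rewrite leNgt;
      apply/negP => xm; apply: phix; apply: phi0; by [left|right].
  by move=> x; rewrite /edge/= !in_itv/= => /andP[mx xM]; lra.
Qed.

Lemma closureU_subset (A B C : set R) :
  closure A `<=` C -> closure B `<=` C -> closure (A `|` B) `<=` C.
Proof. by move=> AC BC; rewrite closureU => x [/AC|/BC]. Qed.

Lemma test_funD phi psi : test_fun phi -> test_fun psi ->
  test_fun (fun x => phi x + psi x).
Proof.
move=> [dphi cphi sphi] [dpsi cpsi spsi].
have e : derive1 (fun x => phi x + psi x) = (fun x => derive1 phi x + derive1 psi x).
  apply: is_derive_derive1 => x; rewrite !derive1E.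
  by apply: is_deriveD; exact: derivableP.
split.
- by move=> x; exact: derivableD.
- by rewrite e => x; apply: cvgD; [exact: cphi|exact: cpsi].
- apply: subset_trans (closureU_subset _ _ _ sphi spsi).
  apply: closureS => x /=; have [->|h] := eqVneq (phi x) 0; last by left.
  by rewrite add0r; right.
Qed.

Lemma test_funM (c c' : R -> R) phi : (forall x, is_derive x 1 c (c' x)) ->
  continuous c' -> test_fun phi -> test_fun (fun x => c x * phi x).
Proof.
move=> dc cc' [dphi cphi sphi].
have e : derive1 (fun x => c x * phi x) = (fun x => c x * derive1 phi x + phi x * c' x).
  apply: is_derive_derive1 => x; rewrite !derive1E.
  have h1 := dc x; have h2 := derivableP (dphi x).
  by apply: is_derive_eq.
have cc := is_derive_continuous _ _ dc.
split.
- by move=> x; apply: derivableM; [case: (dc x)|exact: dphi].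
- rewrite e => x; apply: cvgD; apply: cvgM; [exact: cc|exact: cphi| |exact: cc'].
  by apply: differentiable_continuous; apply/derivable1_diffP.
- apply: subset_trans sphi; apply: closureS => x /=.
  by apply: contra => /eqP ->; rewrite mulr0.
Qed.

Lemma edge_integrable w : {within cedgeR, continuous w} ->
  mu.-integrable edgeR (EFin \o w).
Proof.
move=> wc; apply: (@integrableS _ _ _ mu cedgeR) => //.
- exact: measurable_itv.
- exact: measurable_itv.
- exact: subset_itv_oo_cc.
- apply: continuous_compact_integrable => //; exact: segment_compact.
Qed.

Lemma within_contM u w : {within cedgeR, continuous u} ->
  {within cedgeR, continuous w} ->
  {within cedgeR, continuous (fun x => u x * w x)}.
Proof. by move=> cu cw x; apply: cvgM; [exact: cu|exact: cw]. Qed.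

(** The change of variable sends [al, be] onto the support [0, 3] of the
spline. *)
Definition bump_prim (al be x : R) := spline_prim _ (3 / (be - al) * (x - al)).
Definition bump (al be x : R) :=
  3 / (be - al) * (3 * spline _ (3 / (be - al) * (x - al))).
Definition bump_der (al be x : R) :=
  3 / (be - al) * (3 * (3 / (be - al) * spline_der _ (3 / (be - al) * (x - al)))).

Lemma is_derive_bump_prim al be x :
  is_derive x 1 (bump_prim al be) (bump al be x).
Proof. exact/is_derive_affine/is_derive_spline_prim. Qed.

Lemma is_derive_bump al be x :
  is_derive x 1 (bump al be) (bump_der al be x).
Proof.
have h := is_derive_affine _ _ (3 / (be - al)) al x (is_derive_spline _ _).
by apply: is_derive_eq; rewrite /bump_der /GRing.scale/=; ring.
Qed.

Lemma bump_continuous al be : continuous (bump al be).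
Proof. exact: (is_derive_continuous _ _ (is_derive_bump al be)). Qed.

Lemma bump_der_continuous al be : continuous (bump_der al be).
Proof.
move=> x; do 3 (apply: cvgM; first exact: cvg_cst).
apply: (@continuous_comp _ _ _ (fun x => 3 / (be - al) * (x - al))); last first.
  exact: continuous_spline_der.
by apply: cvgM; [exact: cvg_cst|apply: cvgB; [exact: cvg_id|exact: cvg_cst]].
Qed.

Lemma bump_arg_left al be x : al < be -> x <= al -> 3 / (be - al) * (x - al) <= 0.
Proof. by move=> h1 h2; rewrite pmulr_rle0 ?subr_le0// divr_gt0 ?subr_gt0. Qed.

Lemma bump_arg_right al be x : al < be -> be <= x -> 3 <= 3 / (be - al) * (x - al).
Proof.
move=> h1 h2; rewrite mulrAC ler_pdivlMr ?subr_gt0//; lra.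
Qed.

Lemma bump_prim_left al be x : al < be -> x <= al -> bump_prim al be x = - 6.
Proof. by move=> h1 h2; apply/spline_prim_left/bump_arg_left. Qed.

Lemma bump_prim_right al be x : al < be -> be <= x -> bump_prim al be x = 6.
Proof. by move=> h1 h2; apply/spline_prim_right/bump_arg_right. Qed.

Lemma bump_out al be x : al < be -> x <= al \/ be <= x -> bump al be x = 0.
Proof.
move=> h1 h2; rewrite /bump spline_out ?mulr0//.
by case: h2 => h2; [left; apply/bump_arg_left|right; apply/bump_arg_right].
Qed.

Lemma bump_ge0 al be x : al < be -> 0 <= bump al be x.
Proof.
move=> h1; apply: mulr_ge0; first by rewrite divr_ge0// subr_ge0 ltW.
by rewrite mulr_ge0// spline_ge0.
Qed.

Lemma Rintegral_bump al be : 0 < al -> al < be -> be < 2 * pi ->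
  \int[mu]_(x in edgeR) bump al be x = 12.
Proof.
move=> al0 albe be2.
have c := bump_continuous al be.
have ci A : {within A, continuous (bump al be)} by exact: continuous_subspaceT.
rewrite Rintegral_itv_obnd_cbnd; last by apply: edge_integrable.
rewrite Rintegral_itv_bndo_bndc; last first.
  apply: (@integrableS _ _ _ mu cedgeR) => //.
  - exact: measurable_itv.
  - by apply: subset_itvl; rewrite bnd_simp.
  - apply: continuous_compact_integrable => //; exact: segment_compact.
rewrite /Rintegral (@continuous_FTC2 _ _ (bump_prim al be)) //.
- rewrite (@bump_prim_right _ _ (2 * pi)) ?(@bump_prim_left _ _ 0)//; try lra.
  by rewrite -EFinB; change (6 - - 6 = 12 :> R); ring.
- by lra.
- have cp := is_derive_continuous _ _ (is_derive_bump_prim al be).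
  split.
  + by move=> x _; case: (is_derive_bump_prim al be x).
  + by apply: cvg_at_right_filter; exact: cp.
  + by apply: cvg_at_left_filter; exact: cp.
- by move=> x _; rewrite (is_derive_derive1 _ _ (is_derive_bump_prim al be)).
Qed.

(** Near a point where [w] exceeds [c], possibly an endpoint of the edge, there
is an interval inside the open edge on which [w] exceeds [c]; a bump supported
there averages [w] to at least [c], its total mass being 12. *)
Lemma bump_above w c x : {within cedgeR, continuous w} -> cedgeR x -> c < w x ->
  exists al be, [/\ 0 < al, al < be, be < 2 * pi &
    12 * c <= \int[mu]_(t in edgeR) (w t * bump al be t)].
Proof.
move=> cw xe cx.
have p0 := pi_gt0 R.
have [e e0 we] : exists2 e, 0 < e & forall t, cedgeR t -> `|x - t| < e -> c < w t.
  have := cw x; rewrite /continuous_at /= => /(_ (fun y => c < y)).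
  have h : nbhs (w x) (fun y => c < y) by exact: lt_nbhsr.
  move=> /(_ h); rewrite /nbhs/= -nbhs_subspace_in//.
  rewrite withinE => -[V /nbhs_ballP[e /= e0 Ve] WV].
  exists e => // t te xt.
  have : (V `&` cedgeR) t by split => //; exact: Ve.
  by rewrite -WV => -[].
have [al [be [al0 albe be2 wc]]] : exists al be, [/\ 0 < al, al < be, be < 2 * pi &
    forall t, al <= t <= be -> c <= w t].
  move: xe; rewrite /cedge /= in_itv/= => /andP[x0 x2].
  pose eta := Num.min e pi / 3.
  have [eta0 [etae etap]] : 0 < eta /\ 3 * eta <= e /\ 3 * eta <= pi.
    rewrite /eta; have [h|h] := leP e pi; split; [lra|split; lra|lra|split; lra].
  have [xp|xp] := leP x pi.
    (* Move towards the middle of the edge, to stay away from its endpoints. *)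
    exists (x + eta), (x + 2 * eta); split; try lra.
    move=> t /andP[h1 h2]; apply/ltW/we; first by rewrite /cedge/= in_itv/=; lra.
    by rewrite ler0_norm; lra.
  exists (x - 2 * eta), (x - eta); split; try lra.
  move=> t /andP[h1 h2]; apply/ltW/we; first by rewrite /cedge/= in_itv/=; lra.
  by rewrite ger0_norm; lra.
exists al, be; split => //.
have cb A : {within A, continuous (bump al be)}.
  exact/continuous_subspaceT/bump_continuous.
rewrite mulrC -(Rintegral_bump al be)// -RintegralZl; last 2 first.
- exact: measurable_itv.
- exact: edge_integrable.
apply: le_Rintegral.
- exact: measurable_itv.
- apply/(edge_integrable (fun t => c * bump al be t))/within_contM => //.
  by apply: continuous_subspaceT => ?; exact: cvg_cst.
- exact/(edge_integrable (fun t => w t * bump al be t))/within_contM.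
- move=> t _; have [/andP[h1 h2]|] := boolP (al <= t <= be).
    by rewrite ler_wpM2r ?bump_ge0// wc ?h1.
  rewrite negb_and -!ltNge => h; rewrite bump_out ?mulr0//.
  by case/orP: h => h; [left|right]; exact: ltW.
Qed.

(** If [w y < w x], put a bump near [x] where [w] is large and another one near
[y] where [w] is small.  Their primitives agree outside a compact part of the
open edge, so the difference of these is a test function [phi], and the integral
of [w * phi'] is positive.  Requiring [phi'] to be a test function too weakens
the hypothesis, and lets second-order equations be tested. *)
Lemma du_bois_reymond w : {within cedgeR, continuous w} ->
  (forall phi, test_fun phi -> test_fun (derive1 phi) ->
     \int[mu]_(x in edgeR) (w x * derive1 phi x) = 0) ->
  forall x y, cedgeR x -> cedgeR y -> w x = w y.
Proof.
move=> cw wphi.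
suff H x y : cedgeR x -> cedgeR y -> w x <= w y.
  by move=> x y ex ey; apply/eqP; rewrite eq_le !H.
move=> ex ey; rewrite leNgt; apply/negP => yx.
(* Two levels strictly between [w y] and [w x]. *)
have c1x : (2 * w x + w y) / 3 < w x by lra.
have [al [be [al0 albe be2 I1]]] := bump_above _ _ _ cw ex c1x.
have cNw : {within cedgeR, continuous (fun t => - w t)}.
  by move=> t; apply: cvgN; exact: cw.
have c2y : - ((w x + 2 * w y) / 3) < - w y by lra.
have [al' [be' [al'0 albe' be'2 I2]]] := bump_above _ _ _ cNw ey c2y.
pose phi t := bump_prim al be t - bump_prim al' be' t.
have dphi t : is_derive t 1 phi (bump al be t - bump al' be' t).
  by apply: is_deriveB; exact: is_derive_bump_prim.
have phiE := is_derive_derive1 _ _ dphi.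
have m0 : 0 < Num.min al al' by rewrite lt_min al0.
have M2 : Num.max be be' < 2 * pi by rewrite gt_max be2.
have mM t : t < Num.min al al' \/ Num.max be be' < t ->
    (t <= al /\ t <= al') \/ (be <= t /\ be' <= t).
  rewrite lt_min gt_max => -[/andP[h1 h2]|/andP[h1 h2]]; [left|right];
  by split; exact: ltW.
have cb a b A : {within A, continuous (bump a b)}.
  exact/continuous_subspaceT/bump_continuous.
have : \int[mu]_(x in edgeR) (w x * derive1 phi x) = 0.
  apply: wphi; rewrite ?phiE.
    apply: (test_funI _ _ _ _ dphi) m0 M2 _.
      by move=> t; apply: cvgB; exact: bump_continuous.
    move=> t /mM[[h1 h2]|[h1 h2]]; rewrite /phi.
      by rewrite !bump_prim_left// subrr.
    by rewrite !bump_prim_right// subrr.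
  apply: (test_funI _ (fun t => bump_der al be t - bump_der al' be' t)) m0 M2 _.
  - by move=> t; apply: is_deriveB; exact: is_derive_bump.
  - by move=> t; apply: cvgB; exact: bump_der_continuous.
  - move=> t /mM[[h1 h2]|[h1 h2]]; rewrite !bump_out ?subrr//; by [left|right].
rewrite phiE (@eq_Rintegral _ _ _ mu edgeR
  (fun t => w t * bump al be t + - w t * bump al' be' t)); last first.
  by move=> t _; ring.
rewrite RintegralD; first lra.
- exact: measurable_itv.
- exact/(edge_integrable (fun t => w t * bump al be t))/within_contM.
- exact/(edge_integrable (fun t => - w t * bump al' be' t))/within_contM.
Qed.

End EdgeIntegrals.

(** * Weak solutions of a second-order linear equation *)

Section WeakSolutions.
Variable R : realType.
Implicit Types (x t : R) (U P phi : R -> R).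
Local Notation edgeR := (@edge R).
Local Notation cedgeR := (@cedge R).
Local Notation mu := (@lebesgue_measure R).

(** [P] is the weak derivative of [U] and [- lam * U] that of [P].  Both [phi]
and its derivative are test functions: the second equation is only available
through a square-integrable representative of [P], which is eliminated by
testing against the derivative of [phi]. *)
Definition weak_solution (lam : R) U P := forall phi, test_fun phi ->
  test_fun (derive1 phi) ->
  \int[mu]_(x in edgeR) (U x * derive1 phi x) =
    - (\int[mu]_(x in edgeR) (P x * phi x)) /\
  \int[mu]_(x in edgeR) (P x * derive1 phi x) =
    lam * \int[mu]_(x in edgeR) (U x * phi x).

Lemma test_fun_derivable_continuous phi : test_fun phi -> continuous phi.
Proof.
by move=> [d _ _] x; apply: differentiable_continuous; apply/derivable1_diffP.
Qed.

(** For a classical solution [c], the functions [c * phi] and [c' * phi] are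
test functions.  Testing the equation for [P] against the former and the one for
[U] against the latter, the terms in [lam * U * c * phi] and [P * c' * phi]
cancel, leaving a zero integral of the Wronskian against [phi']. *)
Lemma wronskian_cst lam U P (c c' : R -> R) :
  {within cedgeR, continuous U} -> {within cedgeR, continuous P} ->
  weak_solution lam U P ->
  (forall x, is_derive x 1 c (c' x)) ->
  (forall x, is_derive x 1 c' (- lam * c x)) ->
  forall x y, cedgeR x -> cedgeR y ->
    U x * c' x - P x * c x = U y * c' y - P y * c y.
Proof.
move=> cU cP wUP dc dc'.
have cc := is_derive_continuous _ _ _ dc.
have cc' := is_derive_continuous _ _ _ dc'.
have cc'' : continuous (fun x => - lam * c x).
  by move=> x; apply: cvgM; [exact: cvg_cst|exact: cc].
have wc (h : R -> R) : continuous h -> {within cedgeR, continuous h}.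
  exact: continuous_subspaceT.
apply: (du_bois_reymond _ (fun x => U x * c' x - P x * c x)).
  move=> x; apply: cvgB.
    exact: (within_contM _ _ _ cU (wc _ cc')).
  exact: (within_contM _ _ _ cP (wc _ cc)).
move=> phi tphi tphi'.
have cphi := test_fun_derivable_continuous _ tphi.
have cphi' := test_fun_derivable_continuous _ tphi'.
have dphi x : is_derive x 1 phi (derive1 phi x).
  by rewrite derive1E; apply: derivableP; case: tphi.
have d1 : derive1 (fun x => c x * phi x) = (fun x => c' x * phi x + c x * derive1 phi x).
  apply: is_derive_derive1 => x; have h1 := dc x; have h2 := dphi x.
  by apply: is_derive_eq; rewrite /GRing.scale/=; ring.
have d2 : derive1 (fun x => c' x * phi x) =
    (fun x => - lam * (c x * phi x) + c' x * derive1 phi x).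
  apply: is_derive_derive1 => x; have h1 := dc' x; have h2 := dphi x.
  by apply: is_derive_eq; rewrite /GRing.scale/=; ring.
have t1 : test_fun (fun x => c x * phi x) by exact: test_funM dc cc' tphi.
have t2 : test_fun (fun x => c' x * phi x) by exact: test_funM dc' cc'' tphi.
have t1' : test_fun (derive1 (fun x => c x * phi x)).
  rewrite d1; apply: test_funD => //; exact: test_funM dc cc' tphi'.
have t2' : test_fun (derive1 (fun x => c' x * phi x)).
  rewrite d2; apply: test_funD; last exact: test_funM dc' cc'' tphi'.
  apply: (test_funM _ (fun=> - lam) (fun=> 0)) t1.
  by move=> x; exact: cvg_cst.
have [_ e1] := wUP _ t1 t1'.
have [e2 _] := wUP _ t2 t2'.
have int (V h : R -> R) : {within cedgeR, continuous V} -> continuous h ->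
    mu.-integrable edgeR (EFin \o (fun x => V x * h x)).
  by move=> cV ch; apply/edge_integrable/within_contM => //; exact: wc.
have cM (g h : R -> R) : continuous g -> continuous h ->
    continuous (fun x => g x * h x).
  by move=> cg ch x; apply: cvgM; [exact: cg|exact: ch].
have medge : measurable edgeR by exact: measurable_itv.
move: e1; rewrite d1 (@eq_Rintegral _ _ _ mu edgeR
  (fun x => P x * (c' x * phi x) + P x * (c x * derive1 phi x))); last first.
  by move=> x _; rewrite mulrDr.
rewrite RintegralD //; [|apply: int => //; exact: cM..].
move=> e1; move: e2; rewrite d2 (@eq_Rintegral _ _ _ mu edgeR
  (fun x => - lam * (U x * (c x * phi x)) + U x * (c' x * derive1 phi x))); last first.
  by move=> x _; ring.
rewrite RintegralD //; first last.
- by apply: int => //; exact: cM.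
- apply: (edge_integrable _ (fun x => - lam * (U x * (c x * phi x)))).
  apply: (within_contM _ (fun=> - lam)); first by apply: wc => ?; exact: cvg_cst.
  by apply: within_contM => //; apply: wc; exact: cM.
rewrite RintegralZl //; last by apply: int => //; exact: cM.
move=> e2.
rewrite (@eq_Rintegral _ _ _ mu edgeR
  (fun x => U x * (c' x * derive1 phi x) - P x * (c x * derive1 phi x))); last first.
  by move=> x _; ring.
rewrite RintegralB //; [|apply: int => //; exact: cM..].
lra.
Qed.

(** Both Wronskians of [U] with [c] and [s] keep their value at 0; since that of
[c] and [s] is 1, Cramer's rule recovers [U] and [P]. *)
Lemma weak_solutionE lam U P (c c' s s' : R -> R) :
  {within cedgeR, continuous U} -> {within cedgeR, continuous P} ->
  weak_solution lam U P ->
  (forall x, is_derive x 1 c (c' x)) -> (forall x, is_derive x 1 c' (- lam * c x)) ->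
  (forall x, is_derive x 1 s (s' x)) -> (forall x, is_derive x 1 s' (- lam * s x)) ->
  c 0 = 1 -> c' 0 = 0 -> s 0 = 0 -> s' 0 = 1 ->
  (forall x, c x * s' x - c' x * s x = 1) ->
  forall x, cedgeR x ->
    U x = U 0 * c x + P 0 * s x /\ P x = U 0 * c' x + P 0 * s' x.
Proof.
move=> cU cP wUP dc dc' ds ds' c0 c'0 s0 s'0 W x ex.
have e0 : cedgeR 0.
  by rewrite /cedge/= in_itv/= lexx mulr_ge0// pi_ge0.
have := wronskian_cst _ _ _ _ _ cU cP wUP dc dc' _ _ ex e0.
have := wronskian_cst _ _ _ _ _ cU cP wUP ds ds' _ _ ex e0.
rewrite c0 c'0 s0 s'0 !mulr0 !mulr1 subr0 sub0r => hs hc.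
have Wx := W x.
split.
  transitivity (U x * (c x * s' x - c' x * s x)); first by rewrite Wx mulr1.
  rewrite -hs -[P 0]opprK -hc; ring.
transitivity (P x * (c x * s' x - c' x * s x)); first by rewrite Wx mulr1.
rewrite -hs -[P 0]opprK -hc; ring.
Qed.

End WeakSolutions.

(** * Independence of frequencies and the algebra of the amplitudes *)

Section Trigonometry.
Variable R : realType.
Implicit Types (b c x h k l : R).

Lemma sinusoid_sum k b c x h :
  (b * cos (k * (x + h)) + c * sin (k * (x + h))) +
  (b * cos (k * (x - h)) + c * sin (k * (x - h))) =
  2 * cos (k * h) * (b * cos (k * x) + c * sin (k * x)).
Proof. by rewrite mulrDr mulrBr cosD cosB sinD sinB; ring. Qed.

(** The operator [F |-> F(x + h) + F(x - h)] multiplies a sinusoid of frequency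
[k] by [2 cos (k h)].  Applied to both sides of the identity, and since
[cos (k h) <> cos (l h)], it shows that the sinusoid of frequency [k] takes the
same value at [h], [2 h] and [3 h].  Applied once more, it shows that this value
is 0, because [cos (k h) <> 1].  Two zeros at a distance [h] with
[0 < k h < pi] leave only the zero sinusoid. *)
Lemma sinusoid_sep k l h (A B C A' B' C' : R) : 0 < k -> 0 <= l -> k != l ->
  0 < h -> k * h < pi -> l * h <= pi ->
  (forall x, 0 <= x <= 4 * h ->
    A + (B * cos (k * x) + C * sin (k * x)) =
    A' + (B' * cos (l * x) + C' * sin (l * x))) -> B = 0 /\ C = 0.
Proof.
move=> k0 l0 kl h0 kh lh E.
pose F x := B * cos (k * x) + C * sin (k * x).
pose G x := B' * cos (l * x) + C' * sin (l * x).
have Fh x : F (x + h) + F (x - h) = 2 * cos (k * h) * F x by exact: sinusoid_sum.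
have Gh x : G (x + h) + G (x - h) = 2 * cos (l * h) * G x by exact: sinusoid_sum.
have EFG x : 0 <= x <= 4 * h -> G x = A - A' + F x by move=> /E; rewrite /F /G; lra.
have kh0 : 0 < k * h by exact: mulr_gt0.
have lh0 : 0 <= l * h by rewrite mulr_ge0// ltW.
have cosneq y : 0 <= y <= pi -> y != k * h -> cos (k * h) - cos y != 0.
  move=> yp; apply: contra; rewrite subr_eq0 => /eqP /cos_inj ->//.
    by rewrite in_itv/= !ltW.
have ckl : cos (k * h) - cos (l * h) != 0.
  apply: cosneq; first by rewrite lh0.
  by rewrite (inj_eq (mulIf (lt0r_neq0 h0))) eq_sym.
have ck1 : cos (k * h) - 1 != 0.
  by rewrite -(cos0 R); apply: cosneq; rewrite ?lexx ?pi_ge0// lt_eqF.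
have Fcst x : h <= x <= 3 * h ->
    (cos (k * h) - cos (l * h)) * F x = (A - A') * (cos (l * h) - 1).
  move=> /andP[x1 x2]; have := Gh x; rewrite !EFG; try lra.
  by have := Fh x; lra.
have F12 : F (2 * h - h) = F (2 * h).
  by apply: (mulfI ckl); rewrite !Fcst//; lra.
have F32 : F (2 * h + h) = F (2 * h).
  by apply: (mulfI ckl); rewrite !Fcst//; lra.
have F2 : F (2 * h) = 0.
  apply: (mulfI ck1); rewrite mulr0; have := Fh (2 * h); rewrite F12 F32; lra.
have F3 : F (2 * h + h) = 0 by rewrite F32.
have sk : sin (k * h) != 0 by rewrite gt_eqF// sin_gt0_pi// kh0.
(* The derivative at [2 h] vanishes, up to the factor [k]. *)
have D : C * cos (k * (2 * h)) - B * sin (k * (2 * h)) = 0.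
  apply: (mulfI sk); rewrite mulr0.
  transitivity (F (2 * h + h) - cos (k * h) * F (2 * h)).
    by rewrite /F (mulrDr k) cosD sinD; ring.
  by rewrite F2 F3; ring.
move: F2 (cos2Dsin2 (k * (2 * h))); rewrite /F.
move: (cos _) (sin _) D => c s D F2 cs.
split.
  transitivity (B * (c ^+ 2 + s ^+ 2)); first by rewrite cs mulr1.
  transitivity (c * (B * c + C * s) - s * (C * c - B * s)); first ring.
  by rewrite F2 D; ring.
transitivity (C * (c ^+ 2 + s ^+ 2)); first by rewrite cs mulr1.
transitivity (s * (B * c + C * s) + c * (C * c - B * s)); first ring.
by rewrite F2 D; ring.
Qed.

Lemma modulus_sq_sinusoid (k a1 b1 a2 b2 x : R) :
  (a1 * cos (k / 2 * x) + b1 * sin (k / 2 * x)) ^+ 2 +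
  (a2 * cos (k / 2 * x) + b2 * sin (k / 2 * x)) ^+ 2 =
  (a1 ^+ 2 + a2 ^+ 2 + (b1 ^+ 2 + b2 ^+ 2)) / 2 +
  ((a1 ^+ 2 + a2 ^+ 2 - (b1 ^+ 2 + b2 ^+ 2)) / 2 * cos (k * x) +
   (a1 * b1 + a2 * b2) * sin (k * x)).
Proof.
have -> : k * x = k / 2 * x + k / 2 * x by field.
rewrite cosD sinD.
have := cos2Dsin2 (k / 2 * x); move: (cos _) (sin _) => c s cs.
have -> : s * c + c * s = 2 * (s * c) by ring.
set M := (a1 ^+ 2 + a2 ^+ 2 + (b1 ^+ 2 + b2 ^+ 2)) / 2; transitivity (M * (c ^+ 2 + s ^+ 2) +
  ((a1 ^+ 2 + a2 ^+ 2 - (b1 ^+ 2 + b2 ^+ 2)) / 2 * (c * c - s * s) +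
   (a1 * b1 + a2 * b2) * (2 * (s * c)))); last by rewrite cs mulr1.
by rewrite /M; field.
Qed.

(** The hypotheses say that [b j] is [i a] or [- i a] for the complex numbers
[a = a1 + i a2] and [b j = b1 j + i b2 j].  Hence [Im (conj(a) * b j)], called
[c j] below, is [|a|^2] up to sign, and three such numbers, being an odd number,
cannot cancel unless [a = 0]. *)
Lemma isotropic_sum3 (a1 a2 : R) (b1 b2 : 'I_3 -> R) :
  (forall j, b1 j ^+ 2 + b2 j ^+ 2 = a1 ^+ 2 + a2 ^+ 2) ->
  (forall j, a1 * b1 j + a2 * b2 j = 0) ->
  \sum_(j < 3) b1 j = 0 -> \sum_(j < 3) b2 j = 0 ->
  a1 ^+ 2 + a2 ^+ 2 = 0.
Proof.
move=> bb ab s1 s2.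
set N := a1 ^+ 2 + a2 ^+ 2.
pose c j := a1 * b2 j - a2 * b1 j.
have cN j : c j = N \/ c j = - N.
  (* Lagrange's identity. *)
  have : c j ^+ 2 == N ^+ 2.
    apply/eqP; transitivity (N * (b1 j ^+ 2 + b2 j ^+ 2) - (a1 * b1 j + a2 * b2 j) ^+ 2).
      by rewrite /c /N; ring.
    by rewrite bb ab -/N; ring.
  by rewrite eqf_sqr => /orP[]/eqP; [left|right].
have : \sum_(j < 3) c j = 0 by rewrite sumrB -!mulr_sumr s1 s2 !mulr0 subrr.
rewrite !big_ord_recl big_ord0.
by case: (cN ord0) => ->; case: (cN (lift ord0 ord0)) => ->;
  case: (cN (lift ord0 (lift ord0 ord0))) => ->; lra.
Qed.

End Trigonometry.

(** * Eigenfunctions *)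

Section Eigenfunctions.
Variable R : realType.
Implicit Types (x t : R).
Local Notation cedgeR := (@cedge R).

(** For [0 < k] the values at the second vertex agree automatically.  For
[k = 0] solutions are affine; agreement at both vertices makes the slopes equal,
and the Kirchhoff condition makes them zero, so that the formula with
[cos 0 = 1] and [sin 0 = 0] covers this case as well. *)
Lemma theta_components (k : nat) (U P : 'I_3 -> R -> R) :
  (forall j, {within cedgeR, continuous (U j)}) ->
  (forall j, {within cedgeR, continuous (P j)}) ->
  (forall j, weak_solution _ ((k%:R / 2) ^+ 2) (U j) (P j)) ->
  (forall i j, U i 0 = U j 0) -> (forall i j, U i (2 * pi) = U j (2 * pi)) ->
  \sum_(j < 3) P j 0 = 0 ->
  exists a (b : 'I_3 -> R), \sum_(j < 3) b j = 0 /\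
    forall j x, cedgeR x ->
      U j x = a * cos (k%:R / 2 * x) + b j * sin (k%:R / 2 * x).
Proof.
move=> cU cP wUP U0 U2 P0.
have p0 := pi_gt0 R.
have [k0|k0] := posnP k.
  move: wUP; rewrite k0 => wUP.
  have UE j x : cedgeR x -> U j x = U j 0 * 1 + P j 0 * x.
    move=> ex; apply: proj1; move: x ex; apply: (weak_solutionE _ _ _ _ (fun=> 1)
      (fun=> 0) id (fun=> 1) (cU j) (cP j) (wUP j)) => //.
    - by move=> t; apply: is_derive_eq; rewrite mul0r expr0n/= oppr0 mul0r.
    - by move=> t; apply: is_derive_eq; rewrite mul0r expr0n/= oppr0 mul0r.
    - by move=> t; rewrite mulr1 mul0r subr0.
  have e2 : cedgeR (2 * pi) by rewrite /cedge/= in_itv/= lexx andbT; lra.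
  have PE i j : P i 0 = P j 0.
    have := U2 i j; rewrite (UE i _ e2) (UE j _ e2) (U0 i j) => /addrI; apply: mulIf.
    by rewrite gt_eqF// mulr_gt0.
  have P00 j : P j 0 = 0.
    move: P0; rewrite (eq_bigr (fun=> P j 0)) => [|i _]; last exact: PE.
    by rewrite sumr_const card_ord => /eqP; rewrite mulrn_eq0/= => /eqP.
  exists (U ord0 0), (fun=> 0); split; first by rewrite big1.
  by move=> j x ex; rewrite (UE j x ex) P00 (U0 j ord0) !mul0r cos0 addr0.
pose w : R := k%:R / 2.
have w0 : w != 0 by rewrite mulf_neq0// pnatr_eq0 -lt0n.
exists (U ord0 0), (fun j => P j 0 / w); split.
  by rewrite -mulr_suml P0 mul0r.
have h t : is_derive t 1 (fun x => w * x) w.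
  by apply: is_derive_eq; rewrite /GRing.scale/=; ring.
have dsin t : is_derive t 1 (fun x => sin (w * x)) (w * cos (w * t)).
  have := @is_derive1_comp R sin (fun x => w * x) t _ w (is_derive_sin _) (h t).
  by rewrite mulrC.
have dcos t : is_derive t 1 (fun x => cos (w * x)) (- (w * sin (w * t))).
  have := @is_derive1_comp R cos (fun x => w * x) t _ w (is_derive_cos _) (h t).
  by rewrite mulNr mulrC.
move=> j x ex; rewrite -/w.
have [-> _] : U j x = U j 0 * cos (w * x) + P j 0 * (w^-1 * sin (w * x)) /\
    P j x = U j 0 * - (w * sin (w * x)) + P j 0 * cos (w * x).
  move: x ex; apply: (weak_solutionE _ _ _ _ (fun x => cos (w * x))
    (fun x => - (w * sin (w * x))) (fun x => w^-1 * sin (w * x))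
    (fun x => cos (w * x)) (cU j) (cP j) (wUP j)).
  - by move=> t; have ? := dsin t; apply: is_derive_eq; rewrite /GRing.scale/= -/w; ring.
  - by move=> t; have ? := dsin t; apply: is_derive_eq; rewrite /GRing.scale/=; field.
  - by move=> t; have ? := dcos t; apply: is_derive_eq; rewrite /GRing.scale/= -/w; field.
  - by rewrite mulr0 cos0.
  - by rewrite mulr0 sin0 mulr0 oppr0.
  - by rewrite mulr0 sin0 mulr0.
  - by rewrite mulr0 cos0.
  - by move=> t; rewrite -[RHS](cos2Dsin2 (w * t)); field.
by rewrite (U0 j ord0); ring.
Qed.

End Eigenfunctions.

Section ComplexParts.
Variable R : realType.
Implicit Types (x t : R).
Local Notation edgeR := (@edge R).
Local Notation cedgeR := (@cedge R).
Local Notation mu := (@lebesgue_measure R).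

(** The topology of [R[i]^o] comes from a norm with values in [R[i]]; this
transfers continuity to maps with values in [R]. *)
Lemma nonexpansive_continuous (f : R[i] -> R) :
  (forall z w, `|f z - f w|%:C <= `|z - w|) -> continuous (f : R[i]^o -> R).
Proof.
move=> fle z B /nbhs_ballP[e /= e0 eB]; rewrite /nbhs/=.
exists e%:C; first by rewrite /= ltcR.
by move=> w zw; apply: eB; rewrite /ball/= -ltcR; exact: le_lt_trans (fle z w) zw.
Qed.

Lemma Re_continuous : continuous (@complex.Re R : R[i]^o -> R).
Proof.
apply: nonexpansive_continuous => -[a b] [c d]; rewrite normc_def lecR/=.
by rewrite -sqrtr_sqr ler_wsqrtr// lerDl sqr_ge0.
Qed.

Lemma Im_continuous : continuous (@complex.Im R : R[i]^o -> R).
Proof.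
apply: nonexpansive_continuous => -[a b] [c d]; rewrite normc_def lecR/=.
by rewrite -sqrtr_sqr ler_wsqrtr// lerDr sqr_ge0.
Qed.

Lemma continuous_edge_comp (g : R[i]^o -> R) (u : edge_fun R) : continuous g ->
  continuous_edge u -> {within cedgeR, continuous (fun x => g (u x))}.
Proof.
move=> cg cu x; apply: (@continuous_comp _ _ _ (u : subspace cedgeR -> R[i]^o) g).
  exact: cu.
exact: cg.
Qed.

Lemma weak_deriv_parts (u v : edge_fun R) phi : weak_deriv u v -> test_fun phi ->
  \int[mu]_(x in edgeR) (complex.Re (u x) * derive1 phi x) =
    - (\int[mu]_(x in edgeR) (complex.Re (v x) * phi x)) /\
  \int[mu]_(x in edgeR) (complex.Im (u x) * derive1 phi x) =
    - (\int[mu]_(x in edgeR) (complex.Im (v x) * phi x)).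
Proof.
have ReM (z : R[i]) (r : R) : complex.Re (z * r%:C) = complex.Re z * r.
  by case: z => a b /=; rewrite mulr0 subr0.
have ImM (z : R[i]) (r : R) : complex.Im (z * r%:C) = complex.Im z * r.
  by case: z => a b /=; rewrite mulr0 add0r.
move=> [_ _ h] /h; rewrite /cintegral.
under eq_Rintegral do rewrite ReM.
under [X in _ +i* X = _]eq_Rintegral do rewrite ImM.
under [X in _ = - (X +i* _)]eq_Rintegral do rewrite ReM.
under [X in _ = - (_ +i* X)]eq_Rintegral do rewrite ImM.
by case.
Qed.

Lemma half_natC (k : nat) : ((k%:R / 2) ^+ 2 : R[i]) = ((k%:R / 2) ^+ 2)%:C.
Proof. by rewrite rmorphXn/= rmorphM/= fmorphV/= !rmorph_nat. Qed.

Lemma weak_solution_parts (lam : R) (u du v : edge_fun R) : continuous_edge u ->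
  weak_deriv u du -> weak_deriv u v -> weak_deriv v (fun x => - (lam%:C * u x)) ->
  weak_solution _ lam (fun x => complex.Re (u x)) (fun x => complex.Re (du x)) /\
  weak_solution _ lam (fun x => complex.Im (u x)) (fun x => complex.Im (du x)).
Proof.
move=> cu udu uv vu.
have int (g : R[i]^o -> R) phi : continuous g -> test_fun phi ->
    mu.-integrable edgeR (EFin \o (fun x => g (u x) * phi x)).
  move=> cg tphi; apply/edge_integrable/within_contM.
    exact: continuous_edge_comp.
  exact/continuous_subspaceT/test_fun_derivable_continuous.
have medge : measurable edgeR by exact: measurable_itv.
have ReN x : complex.Re (- (lam%:C * u x)) = - lam * complex.Re (u x).
  by case: (u x) => a b /=; ring.
have ImN x : complex.Im (- (lam%:C * u x)) = - lam * complex.Im (u x).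
  by case: (u x) => a b /=; ring.
split => phi tphi tphi'.
  have [-> _] := weak_deriv_parts _ _ _ udu tphi; split=> //.
  have [e1 _] := weak_deriv_parts _ _ _ udu tphi'.
  have [e2 _] := weak_deriv_parts _ _ _ uv tphi'.
  have [e3 _] := weak_deriv_parts _ _ _ vu tphi.
  move: e1; rewrite e2 => /oppr_inj <-; rewrite e3.
  under eq_Rintegral do rewrite ReN -mulrA.
  rewrite RintegralZl//; last by apply: int => //; exact: Re_continuous.
  by rewrite mulNr opprK.
have [_ ->] := weak_deriv_parts _ _ _ udu tphi; split=> //.
have [_ e1] := weak_deriv_parts _ _ _ udu tphi'.
have [_ e2] := weak_deriv_parts _ _ _ uv tphi'.
have [_ e3] := weak_deriv_parts _ _ _ vu tphi.
move: e1; rewrite e2 => /oppr_inj <-; rewrite e3.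
under eq_Rintegral do rewrite ImN -mulrA.
rewrite RintegralZl//; last by apply: int => //; exact: Im_continuous.
by rewrite mulNr opprK.
Qed.

(** The coefficient [lam] is real, so that the real and imaginary parts of an
eigenfunction satisfy the equation and the vertex conditions separately. *)
Lemma eigenfunction_form (k : nat) (f : graph_fun R) :
  eigenfunction ((k%:R / 2) ^+ 2) f ->
  exists (a1 a2 : R) (b1 b2 : 'I_3 -> R),
    [/\ \sum_(j < 3) b1 j = 0, \sum_(j < 3) b2 j = 0 &
    forall j x, cedgeR x -> f j x =
      (a1 * cos (k%:R / 2 * x) + b1 j * sin (k%:R / 2 * x)) +i*
      (a2 * cos (k%:R / 2 * x) + b2 j * sin (k%:R / 2 * x))].
Proof.
rewrite half_natC => -[[[fH f0 f2 [df [dfP df0 _]]] fv] _].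
have cf j : continuous_edge (f j) by case: (fH j).
have cdf j : continuous_edge (df j) by case: (dfP j).
have wk j := let: ex_intro v (conj uv vu) := fv j in
  weak_solution_parts _ _ _ _ (cf j) (proj1 (dfP j)) uv vu.
have sums : \sum_(j < 3) complex.Re (df j 0) = 0 /\
    \sum_(j < 3) complex.Im (df j 0) = 0.
  move: df0; rewrite !big_ord_recl !big_ord0.
  case: (df _ _) => a b; case: (df _ _) => c d; case: (df _ _) => p q /=.
  by case => -> ->.
have [a1 [b1 [sb1 f1E]]] := theta_components _ k
  (fun j x => complex.Re (f j x)) (fun j x => complex.Re (df j x))
  (fun j => continuous_edge_comp _ _ Re_continuous (cf j))
  (fun j => continuous_edge_comp _ _ Re_continuous (cdf j))
  (fun j => proj1 (wk j))
  (fun i j => congr1 _ (f0 i j)) (fun i j => congr1 _ (f2 i j)) (proj1 sums).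
have [a2 [b2 [sb2 f2E]]] := theta_components _ k
  (fun j x => complex.Im (f j x)) (fun j x => complex.Im (df j x))
  (fun j => continuous_edge_comp _ _ Im_continuous (cf j))
  (fun j => continuous_edge_comp _ _ Im_continuous (cdf j))
  (fun j => proj2 (wk j))
  (fun i j => congr1 _ (f0 i j)) (fun i j => congr1 _ (f2 i j)) (proj2 sums).
exists a1, a2, b1, b2; split => // j x ex.
by rewrite -(f1E j x ex) -(f2E j x ex); case: (f j x).
Qed.

Lemma normc_eq_sq (z w : R[i]) : `|z| = `|w| ->
  complex.Re z ^+ 2 + complex.Im z ^+ 2 = complex.Re w ^+ 2 + complex.Im w ^+ 2.
Proof.
rewrite !normc_def => -[] /(congr1 (fun y => y ^+ 2)).
by rewrite !sqr_sqrtr// addr_ge0// sqr_ge0.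
Qed.

(** The squared moduli agree, so the sinusoid of frequency [k] in [|f j|^2]
vanishes on each edge; this is what [isotropic_sum3] needs. *)
Lemma positive_frequency_moduli (k l : nat) (f g : graph_fun R) :
  (0 < k)%N -> k <> l ->
  eigenfunction ((k%:R / 2) ^+ 2) f -> eigenfunction ((l%:R / 2) ^+ 2) g ->
  ~ same_modulus f g.
Proof.
move=> k0 kl hf hg fg.
have [a1 [a2 [b1 [b2 [sb1 sb2 fE]]]]] := eigenfunction_form k f hf.
have [c1 [c2 [d1 [d2 [_ _ gE]]]]] := eigenfunction_form l g hg.
have p0 := pi_gt0 R.
have kR : 0 < k%:R :> R by rewrite ltr0n.
have lR : 0 <= l%:R :> R by rewrite ler0n.
have klR : 1 <= k%:R + l%:R :> R.
  by rewrite -natrD ler1n addn_gt0 k0.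
(* With this step, [k h] and [l h] are at most [pi / 2], and the five points
   0, h, .., 4 h lie on the edge as [1 <= k + l]. *)
pose h : R := pi / (2 * (k%:R + l%:R)).
have den0 : 0 < 2 * (k%:R + l%:R) :> R by lra.
have h0 : 0 < h by rewrite divr_gt0.
have h4 : 4 * h <= 2 * pi.
  by rewrite /h mulrA ler_pdivrMr//; nra.
have hsum : (k%:R + l%:R) * h = pi / 2.
  have kl0 : k%:R + l%:R != 0 :> R by rewrite gt_eqF//; lra.
  by rewrite /h; move: (k%:R : R) (l%:R : R) kl0 => K L kl0; field.
have kh : 0 < k%:R * h by exact: mulr_gt0.
have lh : 0 <= l%:R * h by rewrite mulr_ge0// ltW.
have bal j : a1 ^+ 2 + a2 ^+ 2 - (b1 j ^+ 2 + b2 j ^+ 2) = 0 /\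
    a1 * b1 j + a2 * b2 j = 0.
  have [||||B0 C0] := sinusoid_sep _ k%:R l%:R h
    ((a1 ^+ 2 + a2 ^+ 2 + (b1 j ^+ 2 + b2 j ^+ 2)) / 2)
    ((a1 ^+ 2 + a2 ^+ 2 - (b1 j ^+ 2 + b2 j ^+ 2)) / 2)
    (a1 * b1 j + a2 * b2 j)
    ((c1 ^+ 2 + c2 ^+ 2 + (d1 j ^+ 2 + d2 j ^+ 2)) / 2)
    ((c1 ^+ 2 + c2 ^+ 2 - (d1 j ^+ 2 + d2 j ^+ 2)) / 2)
    (c1 * d1 j + c2 * d2 j) kR lR _ h0.
  - by rewrite eqr_nat; apply/eqP.
  - lra.
  - lra.
  - move=> x /andP[x0 x4].
    have ex : cedgeR x by rewrite /cedge/= in_itv/=; lra.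
    by have := normc_eq_sq _ _ (fg j x ex); rewrite fE// gE//= !modulus_sq_sinusoid.
  by split=> //; lra.
have N0 : a1 ^+ 2 + a2 ^+ 2 = 0.
  apply: (isotropic_sum3 _ _ _ b1 b2) => // j; last by case: (bal j).
  by have [+ _] := bal j; lra.
have sq0 (x y : R) : x ^+ 2 + y ^+ 2 = 0 -> x = 0 /\ y = 0.
  move=> /eqP; rewrite paddr_eq0 ?sqr_ge0// !sqrf_eq0 => /andP[/eqP -> /eqP ->].
  by [].
have [a10 a20] := sq0 _ _ N0.
case: hf => _ [j [x [ex]]]; rewrite fE//.
have [-> ->] : b1 j = 0 /\ b2 j = 0.
  by apply: sq0; have [+ _] := bal j; rewrite N0; lra.
by rewrite a10 a20 !mul0r addr0 eqxx.
Qed.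

End ComplexParts.

Theorem proposition4p13 (R : realType) (k l : nat) (hkl : k <> l)
    (f g : graph_fun R)
    (hf : eigenfunction ((k%:R / 2) ^+ 2) f)
    (hg : eigenfunction ((l%:R / 2) ^+ 2) g) :
  ~ same_modulus f g.
Proof.
have [k0|k0] := posnP k; last exact: positive_frequency_moduli hkl hf hg.
have l0 : (0 < l)%N by rewrite lt0n; apply/eqP => l0; apply: hkl; rewrite k0 l0.
move=> fg; apply: (positive_frequency_moduli _ _ _ _ _ l0 (nesym hkl) hg hf).
by move=> j x ex; rewrite fg.
Qed.
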